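(* Let $\Bbbk$ be a field, let $\mathcal A=\{H_1,\dots,H_n\}$ be a central arrangement of $n$ distinct linear hyperplanes in $\mathbb C^\ell$ with underlying matroid $\mathfrak G$, let $\Gamma\in\mathcal N(\mathfrak G,\Bbbk)$, and assume $\overline V(\Gamma,\Bbbk)$ is nonempty. Then $$\overline V(\Gamma,\Bbbk)=|\mathsf L(\mathcal D_\Gamma)|,$$ that is, $\overline V(\Gamma,\Bbbk)$ is the union of all the lines in $\mathbb P(K(\Gamma,\Bbbk))$ that meet $\mathbb P(D_S)$ for every block $S$ of $\Gamma$.
   Context: Write $[n]=\{1,\dots,n\}$. The matroid $\mathfrak G$ is the matroid on $[n]$ whose circuits are the minimal sets $C\subseteq[n]$ with $\operatorname{codim}(\bigcap_{i\in C}H_i)<|C|$. A line of $\mathfrak G$ is a rank-two flat, i.e. a set $\{m\in[n]: H_m\supseteq H_i\cap H_j\}$ with $i\ne j$; $\mathcal X(\mathfrak G)$ is the set of lines, and $\mathcal X_0(\mathfrak G)$ is the set of lines $X$ with $|X|\ge3$ (nontrivial lines). For $S\subseteq[n]$ and $\xi\in\Bbbk^n$, $\xi_S=\sum_{i\in S}\xi_i$. Let $\Gamma$ be a (simple) graph with vertex set $[n]$. A clique is a set of pairwise adjacent vertices; a block is a maximal clique. $\Gamma$ is $\mathfrak G$-neighborly if for every $X\in\mathcal X(\mathfrak G)$ and every block $S$ of $\Gamma$, $|X\cap S|\ge|X|-1$ implies $X\subseteq S$. Let $\mathcal X_\Gamma(\mathfrak G)=\{X\in\mathcal X_0(\mathfrak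 G): X\text{ is not a clique of }\Gamma\}$ and $K(\Gamma,\Bbbk)=\{\xi\in\Bbbk^n:\xi_X=0\text{ for every }X\in\mathcal X_\Gamma(\mathfrak G)\}$. For $\lambda\in K(\Gamma,\Bbbk)$ let $Z_\Gamma(\lambda,\Bbbk)=\{\eta\in K(\Gamma,\Bbbk):\lambda_i\eta_j-\lambda_j\eta_i=0\text{ for every edge }\{i,j\}\text{ of }\Gamma\}$, a linear subspace. $\mathcal N(\mathfrak G,\Bbbk)$ is the set of $\mathfrak G$-neighborly graphs $\Gamma$ with vertex set $[n]$ and $\dim K(\Gamma,\Bbbk)\ge2$. For $\Gamma\in\mathcal N(\mathfrak G,\Bbbk)$, $V(\Gamma,\Bbbk)=\{\lambda\in K(\Gamma,\Bbbk):\dim_\Bbbk Z_\Gamma(\lambda,\Bbbk)\ge 2\}$, and $\overline V(\Gamma,\Bbbk)=\{\Bbbk\lambda:\lambda\in V(\Gamma,\Bbbk)\setminus\{0\}\}\subseteq\mathbb P(K(\Gamma,\Bbbk))$ is its projective image. Here $\mathbb P(K)=\{\Bbbk\xi:\xi\in K\setminus\{0\}\}$. For a block $S$ of $\Gamma$, $D_S=\{\xi\in K(\Gamma,\Bbbk):\xi_i=0\text{ for all }i\in S\}$; the arrangement of directrices $\mathcal D_\Gamma$ is the collection of subspaces $D_S$, $S$ a block of $\Gamma$. For a subspace $D$ of $K=K(\Gamma,\Bbbk)$, $\mathsf L_D$ is the set of projective lines $L$ in $\mathbb P(K)$ with $L\cap\mathbb P(D)\ne\emptyset$; for a collection $\mathcal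 D$ of subspaces, $\mathsf L(\mathcal D)=\bigcap_{D\in\mathcal D}\mathsf L_D$. The carrier $|\mathsf L|$ of a set $\mathsf L$ of lines is the union of the lines in $\mathsf L$. *)

(* Defs.v *)
From HB Require Import structures.
From mathcomp Require Import all_boot all_order all_algebra.
From mathcomp Require Import all_classical all_reals.
From mathcomp Require Import complex.

Set Implicit Arguments.
Unset Strict Implicit.
Unset Printing Implicit Defensive.

Import GRing.Theory.
Local Open Scope classical_set_scope.
Local Open Scope ring_scope.

Section Arrangement.
Variables (F : fieldType) (l n : nat).
Implicit Type H : 'I_n -> {vspace 'rV[F]_l}.

Definition arrangement H : Prop :=
  injective H /\ forall i, (\dim (H i)).+1 = l.

(* The rank-two flat of the underlying matroid spanned by i and j (i != j),
   written out in terms of the hyperplanes. *)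
Definition line_through H (i j : 'I_n) : {set 'I_n} :=
  [set m | (H i :&: H j <= H m)%VS]%SET.

Definition matroid_lines H : {set {set 'I_n}} :=
  [set X | [exists i, exists j, (i != j) && (X == line_through H i j)]]%SET.

Definition nontrivial_lines H : {set {set 'I_n}} :=
  [set X in matroid_lines H | (3 <= #|X|)%N]%SET.

End Arrangement.

Section Graph.
Variable n : nat.
Implicit Types (Gamma : rel 'I_n) (S : {set 'I_n}).

Definition simple_graph Gamma : Prop := symmetric Gamma /\ irreflexive Gamma.

Definition clique Gamma S : bool :=
  [forall i in S, forall j in S, (i != j) ==> Gamma i j].

Definition block Gamma S : bool := maxset (clique Gamma) S.

End Graph.

Section Projective.
Variables (k : fieldType) (n : nat).
Implicit Types (K D W : {vspace 'rV[k]_n}).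

(* A projective point is the corresponding one-dimensional subspace. *)
Definition proj K : set {vspace 'rV[k]_n} :=
  [set p | exists xi, [/\ xi \in K, xi != 0 & p = <[xi]>%VS]].

Definition proj_lines K : set (set {vspace 'rV[k]_n}) :=
  [set L | exists W, [/\ (W <= K)%VS, \dim W = 2%N & L = proj W]].

Definition lines_meeting K D : set (set {vspace 'rV[k]_n}) :=
  [set L | proj_lines K L /\ (L `&` proj D) !=set0].

(* The first factor only matters for an empty family, whose intersection is
   then the set of all projective lines. *)
Definition lines_meeting_all K (DD : set {vspace 'rV[k]_n}) :
    set (set {vspace 'rV[k]_n}) :=
  proj_lines K `&` \bigcap_(D in DD) lines_meeting K D.

Definition carrier (LL : set (set {vspace 'rV[k]_n})) :
    set {vspace 'rV[k]_n} :=
  \bigcup_(L in LL) L.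

End Projective.

Section Resonance.
Variables (F : fieldType) (l n : nat) (H : 'I_n -> {vspace 'rV[F]_l}).
Variables (Gamma : rel 'I_n) (k : fieldType).

Definition neighborly : Prop :=
  forall X S : {set 'I_n}, X \in matroid_lines H -> block Gamma S ->
    (#|X| - 1 <= #|X :&: S|)%N -> X \subset S.

Definition nonclique_lines : {set {set 'I_n}} :=
  [set X in nontrivial_lines H | ~~ clique Gamma X]%SET.

Definition coord_sum (X : {set 'I_n}) (xi : 'rV[k]_n) : k^o :=
  \sum_(i in X) xi 0 i.

Fact coord_sum_linear X : linear (coord_sum X).
Proof.
move=> a u v; rewrite /coord_sum scaler_sumr -big_split /=.
by apply: eq_bigr => i _; rewrite !mxE.
Qed.
HB.instance Definition _ X :=
  GRing.isLinear.Build k 'rV[k]_n k^o _ (coord_sum X) (coord_sum_linear X).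

Definition Kspace : {vspace 'rV[k]_n} :=
  (\bigcap_(X in nonclique_lines) lker (linfun (coord_sum X)))%VS.

Lemma KspaceP (xi : 'rV[k]_n) :
  reflect (forall X, X \in nonclique_lines -> \sum_(i in X) xi 0 i = 0)
          (xi \in Kspace).
Proof.
rewrite memvE; apply: (iffP subv_bigcapP) => h X /h.
  by rewrite -memvE memv_ker lfunE => /eqP.
by move=> e; rewrite -memvE memv_ker lfunE; apply/eqP.
Qed.

Definition minor2 (lam : 'rV[k]_n) (i j : 'I_n) (eta : 'rV[k]_n) : k^o :=
  lam 0 i * eta 0 j - lam 0 j * eta 0 i.

Fact minor2_linear lam i j : linear (minor2 lam i j).
Proof.
move=> a u v; rewrite /minor2 !mxE !mulrDr scalerBr /GRing.scale /=.
by rewrite opprD addrACA !(mulrCA _ a).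
Qed.
HB.instance Definition _ lam i j :=
  GRing.isLinear.Build k 'rV[k]_n k^o _ (minor2 lam i j)
    (minor2_linear lam i j).

Definition Zspace (lam : 'rV[k]_n) : {vspace 'rV[k]_n} :=
  (Kspace :&:
   \bigcap_(e : 'I_n * 'I_n | Gamma e.1 e.2)
      lker (linfun (minor2 lam e.1 e.2)))%VS.

Lemma ZspaceP (lam eta : 'rV[k]_n) :
  reflect (eta \in Kspace /\
           forall i j, Gamma i j -> lam 0 i * eta 0 j - lam 0 j * eta 0 i = 0)
          (eta \in Zspace lam).
Proof.
rewrite memv_cap; apply: (iffP andP) => -[Keta h]; split=> //.
  move=> i j Gij; move: h; rewrite memvE => /subv_bigcapP/(_ (i, j) Gij).
  by rewrite -memvE memv_ker lfunE => /eqP.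
rewrite memvE; apply/subv_bigcapP => -[i j] /= /h e.
by rewrite -memvE memv_ker lfunE; apply/eqP.
Qed.

Definition Nclass : Prop :=
  [/\ simple_graph Gamma, neighborly & (2 <= \dim Kspace)%N].

Definition V : set 'rV[k]_n :=
  [set lam | lam \in Kspace /\ (2 <= \dim (Zspace lam))%N].

Definition Vbar : set {vspace 'rV[k]_n} :=
  [set p | exists lam, [/\ V lam, lam != 0 & p = <[lam]>%VS]].

Definition coordinate (i : 'I_n) (xi : 'rV[k]_n) : k^o := xi 0 i.

Fact coordinate_linear i : linear (coordinate i).
Proof. by move=> a u v; rewrite /coordinate !mxE. Qed.
HB.instance Definition _ i :=
  GRing.isLinear.Build k 'rV[k]_n k^o _ (coordinate i)
    (coordinate_linear i).

Definition directrix (S : {set 'I_n}) : {vspace 'rV[k]_n} :=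
  (Kspace :&: \bigcap_(i in S) lker (linfun (coordinate i)))%VS.

Lemma directrixP (S : {set 'I_n}) (xi : 'rV[k]_n) :
  reflect (xi \in Kspace /\ forall i, i \in S -> xi 0 i = 0)
          (xi \in directrix S).
Proof.
rewrite memv_cap; apply: (iffP andP) => -[Kxi h]; split=> //.
  move=> i iS; move: h; rewrite memvE => /subv_bigcapP/(_ i iS).
  by rewrite -memvE memv_ker lfunE => /eqP.
rewrite memvE; apply/subv_bigcapP => i /h e.
by rewrite -memvE memv_ker lfunE; apply/eqP.
Qed.

Definition directrices : set {vspace 'rV[k]_n} :=
  directrix @` [set S | block Gamma S].

End Resonance.

Arguments Kspace {F l n} H Gamma k.
Arguments Nclass {F l n} H Gamma k.
Arguments V {F l n} H Gamma k _.
Arguments Vbar {F l n} H Gamma k _.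
Arguments directrices {F l n} H Gamma k _.

(* Main.v *)
(** Two vectors of [K] whose minors vanish on a clique [S] have proportional
restrictions to [S], so some nonzero combination of them lies in [D_S].
Conversely, the minor [(i, j)] is an alternating form on a plane [W], and a
nonzero vector of [W] lying in [D_S] with [i, j \in S] is in its radical, so the
minor vanishes on [W].  Thus a plane [W] of [K] through [lambda] lies in
[Z(lambda)] exactly when [P(W)] meets every directrix. *)
Require Import Defs.
From mathcomp Require Import all_boot all_order all_algebra.
From mathcomp Require Import all_classical all_reals.
From mathcomp Require Import complex.
From mathcomp Require Import ring.

Local Open Scope classical_set_scope.

Section Planes.
Local Set Implicit Arguments.
Local Unset Strict Implicit.
Import GRing.Theory.
Local Open Scope ring_scope.
Variables (k : fieldType) (vT : vectType k).
Implicit Types (u v w : vT) (W : {vspace vT}).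

Lemma dimv_plane u v :
  u != 0 -> v \notin <[u]>%VS -> \dim (<[v]> + <[u]>) = 2%N.
Proof.
move=> u0 vu; have: free [:: v; u] by rewrite free_cons span_seq1 vu seq1_free.
by move=> /eqP; rewrite span_cons span_seq1.
Qed.

(** The independent vectors [u] and [v] already span a subspace of [W] of full dimension 2. *)
Lemma plane_decomp W u v w : \dim W = 2%N ->
  u \in W -> v \in W -> w \in W -> u != 0 -> v \notin <[u]>%VS ->
  exists a b, w = a *: v + b *: u.
Proof.
move=> dW uW vW wW u0 vu.
have eW : (<[v]> + <[u]>)%VS = W.
  apply/eqP; rewrite eqEdim dimv_plane // dW leqnn andbT.
  by rewrite subv_add -!memvE vW uW.
move: wW; rewrite -eW => /memv_addP[_ /vlineP[a ->] [_ /vlineP[b ->] ->]].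
by exists a, b.
Qed.

Lemma plane_comb_neq0 u v a b : u != 0 -> v \notin <[u]>%VS ->
  (a != 0) || (b != 0) -> a *: u + b *: v != 0.
Proof.
move=> u0 vu ab; apply/eqP => e.
have [b0|b0] := eqVneq b 0.
  move: ab e; rewrite b0 eqxx orbF scale0r addr0 => a0 /eqP.
  by rewrite scaler_eq0 (negPf a0) (negPf u0).
case/negP: vu; apply/vlineP; exists (- (b^-1 * a)).
have /(congr1 ( *:%R b^-1)) : b *: v = - (a *: u).
  by apply/eqP; rewrite -addr_eq0 addrC e.
by rewrite scalerA mulVf // scale1r scalerN scalerA scaleNr.
Qed.

End Planes.

Section Directrices.
Local Set Implicit Arguments.
Local Unset Strict Implicit.
Import GRing.Theory.
Local Open Scope ring_scope.
Variables (F : fieldType) (l n : nat) (H : 'I_n -> {vspace 'rV[F]_l}).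
Variables (Gamma : rel 'I_n) (k : fieldType).
Implicit Types (lam eta xi : 'rV[k]_n) (S : {set 'I_n}).

(** An edge is a clique on two vertices, hence extends to a maximal one. This lets conditions on
    edges be checked block by block. *)
Lemma edge_block i j : symmetric Gamma -> Gamma i j ->
  exists S, [/\ block Gamma S, i \in S & j \in S].
Proof.
move=> sG Gij.
have /maxset_exists[S bS sS] : clique Gamma [set i; j]%SET.
  apply/forall_inP => x xij; apply/forall_inP => y yij; apply/implyP.
  move: xij yij; rewrite !inE.
  by case/orP => /eqP-> /orP[] /eqP->; rewrite ?eqxx // sG.
by exists S; split=> //; apply: (fintype.subsetP sS); rewrite !inE eqxx ?orbT.
Qed.

Lemma block_edge S i j :
  block Gamma S -> i \in S -> j \in S -> i != j -> Gamma i j.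
Proof.
by move=> /maxsetp /forall_inP h /h /forall_inP h' /h' /implyP.
Qed.

Lemma Zspace_block_dependent lam eta S :
  block Gamma S -> eta \in Zspace H Gamma lam ->
  exists a b, (a != 0) || (b != 0) /\
    forall j, j \in S -> (a *: lam + b *: eta) 0 j = 0.
Proof.
move=> bS /ZspaceP[_ min0].
case: (pickP [pred i in S | lam 0 i != 0]) => [i /andP[iS li]|l0].
  (* With the pivot [lam 0 i] nonzero, coordinate [j] of this combination is minus the minor at
     [(i, j)], which vanishes because distinct vertices of a block are adjacent. *)
  exists (eta 0 i), (- lam 0 i); split; first by rewrite oppr_eq0 li orbT.
  move=> j jS; rewrite !mxE.
  have [<-|ij] := eqVneq i j; first by ring.
  have := min0 _ _ (block_edge bS iS jS ij) => m.
  by transitivity (- (lam 0 i * eta 0 j - lam 0 j * eta 0 i));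
    [ring | rewrite m oppr0].
(* Without a pivot, [lam] itself vanishes on [S]. *)
exists 1, 0; split; first by rewrite oner_eq0.
move=> j jS; rewrite !mxE mul0r addr0 mul1r.
by have /= := l0 j; rewrite jS => /negbFE/eqP.
Qed.

Lemma Vbar_sub_carrier : Vbar H Gamma k `<=`
  carrier (lines_meeting_all (Kspace H Gamma k) (directrices H Gamma k)).
Proof.
move=> _ [lam [[lamK dZ] lam0 ->]].
(* As [Zspace H Gamma lam] has dimension at least 2, it contains some [eta] off the line of [lam];
   the plane [W] spanned by both gives the required projective line. *)
have /subvPn[eta etaZ eta_lam] : ~~ (Zspace H Gamma lam <= <[lam]>)%VS.
  by apply/negP => /dimvS; rewrite dim_vline lam0 leqNgt dZ.
have etaK : eta \in Kspace H Gamma k by case/ZspaceP: etaZ.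
pose W := (<[eta]> + <[lam]>)%VS.
have lineW : proj_lines (Kspace H Gamma k) (Defs.proj W).
  exists W; split=> //; last exact: dimv_plane.
  by rewrite subv_add -!memvE etaK.
have lamW : lam \in W by rewrite memvE addvSr.
have etaW : eta \in W by rewrite memvE addvSl.
exists (Defs.proj W); last by exists lam.
split=> // _ [S bS <-]; split=> //.
have [a [b [ab vanish]]] := Zspace_block_dependent bS etaZ.
have comb0 := plane_comb_neq0 lam0 eta_lam ab.
exists <[a *: lam + b *: eta]>%VS; split; exists (a *: lam + b *: eta).
  by split=> //; rewrite rpredD // rpredZ.
by split=> //; apply/directrixP; split=> //; rewrite rpredD // rpredZ.
Qed.

Lemma minor2_plane_eq0 (W : {vspace 'rV[k]_n}) lam eta xi i j :
  \dim W = 2%N -> lam \in W -> eta \in W -> xi \in W -> xi != 0 ->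
  xi 0 i = 0 -> xi 0 j = 0 -> lam 0 i * eta 0 j - lam 0 j * eta 0 i = 0.
Proof.
move=> dW lamW etaW xiW xi0 xii xij.
have [/vlineP[a ->]|lam_xi] := boolP (lam \in <[xi]>%VS).
  by rewrite !mxE xii xij; ring.
(* Now [eta] is [a *: lam + b *: xi]: the [lam] part cancels by antisymmetry, and [xi] contributes
   nothing at [i] and [j]. *)
have [a [b ->]] := plane_decomp dW xiW lamW etaW xi0 lam_xi.
by rewrite !mxE xii xij; ring.
Qed.

Lemma carrier_sub_Vbar : symmetric Gamma ->
  carrier (lines_meeting_all (Kspace H Gamma k) (directrices H Gamma k))
    `<=` Vbar H Gamma k.
Proof.
move=> sG _ [_ [[W [WK dW ->]] meet] [lam [lamW lam0 ->]]].
exists lam; split=> //; split; first exact: (subvP WK).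
(* It suffices that the whole plane [W] lies in [Zspace H Gamma lam]. *)
rewrite -dW; apply/dimvS/subvP => eta etaW; apply/ZspaceP.
split=> [|i j /(edge_block sG)[S [bS iS jS]]]; first exact: (subvP WK).
have [_ [p [[xi [xiW xi0 ->]] [zeta [zetaD _ e]]]]] :
    lines_meeting (Kspace H Gamma k) (directrix H Gamma k S) (Defs.proj W).
  by apply: meet; exists S.
(* The common point of the line and the directrix has one generator in [W] and another in the
   directrix; being proportional, [xi] lies in both. *)
have /vlineP[c xiE] : xi \in <[zeta]>%VS by rewrite -e memv_line.
have /directrixP[_ xiS] : xi \in directrix H Gamma k S by rewrite xiE rpredZ.
by apply: (minor2_plane_eq0 dW lamW etaW xiW xi0); exact: xiS.
Qed.

End Directrices.

Theorem corollary3p2 (R : realType) (k : fieldType) (l n : nat)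
    (H : 'I_n -> {vspace 'rV[R[i]]_l}) (Gamma : rel 'I_n) :
  arrangement H -> Nclass H Gamma k -> Vbar H Gamma k !=set0 ->
  Vbar H Gamma k =
  carrier (lines_meeting_all (Kspace H Gamma k) (directrices H Gamma k)).
Proof.
move=> _ [[sG _] _ _] _; apply/seteqP; split; first exact: Vbar_sub_carrier.
exact: carrier_sub_Vbar.
Qed.
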